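(* Let $N_1,N_2\in\mathbb{N}$, $\tau\in\mathbb{N}_0$. For $i\in\{1,\ldots,N_1\}$ and $j\in\{1,\ldots,N_2\}$ let $\hat c_i,\tilde c_j\in(-1,1)$ and $\hat a_{ij},\tilde a_{ji},\hat b_{ij},\tilde b_{ji},\hat I_i,\tilde I_j\in\mathbb{R}$ be constants, let $\hat\tau_{ij},\tilde\tau_{ji}:\mathbb{N}_0\to\mathbb{N}_0$ be bounded functions, and let $f_j,g_i:\mathbb{R}\to\mathbb{R}$ be Lipschitz functions with Lipschitz constants $F_j$ and $G_i$, respectively. Consider the model $$\begin{cases}x_i(m+1)=\hat c_i x_i(m-\tau)+\sum_{j=1}^{N_2}\hat a_{ij}f_j(y_j(m))+\sum_{j=1}^{N_2}\hat b_{ij}f_j(y_j(m-\hat\tau_{ij}(m)))+\hat I_i,& i=1,\ldots,N_1,\\[4pt] y_j(m+1)=\tilde c_j y_j(m-\tau)+\sum_{i=1}^{N_1}\tilde a_{ji}g_i(x_i(m))+\sum_{i=1}^{N_1}\tilde b_{ji}g_i(x_i(m-\tilde\tau_{ji}(m)))+\tilde I_j,& j=1,\ldots,N_2,\end{cases}$$ for $m\in\mathbb{N}_0$. If the $(N_1+N_2)\times(N_1+N_2)$ matrix $$\mathcal{I}-\mathrm{diag}(|\hat c_1|,\ldots,|\hat c_{N_1}|,|\tilde c_1|,\ldots,|\tilde c_{N_2}|)-\begin{bmatrix}0&\big((|\hat a_{ij}|+|\hat b_{ij}|)F_j\big)_{ij}\\ \big((|\tilde a_{ji}|+|\tilde b_{ji}|)G_i\big)_{ji}&0\end{bmatrix}$$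 (with $\mathcal{I}$ the identity matrix, upper-right block of size $N_1\times N_2$ with the displayed $(i,j)$ entry, and lower-left block of size $N_2\times N_1$ with the displayed $(j,i)$ entry) is a non-singular M-matrix, then the model has a unique equilibrium, and this equilibrium is globally exponentially stable.
   Context: $\mathbb{N}=\{1,2,\ldots\}$, $\mathbb{N}_0=\mathbb{N}\cup\{0\}$. Put $N=N_1+N_2$ and $r=-\max_{i,j,m}\{\hat\tau_{ij}(m),\tilde\tau_{ji}(m),\tau\}$. For $I\subseteq\mathbb{R}$, $I_{\mathbb{Z}}=I\cap\mathbb{Z}$. $X$ is the space of functions $\alpha:[r,0]_{\mathbb{Z}}\to\mathbb{R}$ with norm $\|\alpha\|=\max_{l=r,\ldots,0}|\alpha(l)|$. $X^N$ carries the norm $\|\overline\alpha\|=\max_{i=1,\ldots,N}\|\alpha_i\|$. A solution is written $\overline{z}=(x_1,\ldots,x_{N_1},y_1,\ldots,y_{N_2}):[r,+\infty)_{\mathbb{Z}}\to\mathbb{R}^N$, and $\overline{z}_m\in X^N$ is defined by $\overline{z}_m(l)=\overline{z}(m+l)$, $l=r,\ldots,0$. For $\overline\alpha\in X^N$, $\overline{z}(\cdot,\overline\alpha)$ is the unique solution with $\overline{z}_0=\overline\alpha$, and $\overline{z}_m(\cdot,\overline\alpha)$ is its segment at time $m$. An equilibrium is a point of $\mathbb{R}^N$ such that the constant function on $[r,+\infty)_{\mathbb{Z}}$ with that value is a solution. It is globally exponentially stable if, denoting by $\overline{z}^*$ this constant solution, there are $C>0$ and $\zeta\in(0,1)$ such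 that $\|\overline{z}_m(\cdot,\overline\alpha)-\overline{z}^*_m\|\le C\zeta^m\|\overline\alpha-\overline{z}^*_0\|$ for all $\overline\alpha\in X^N$ and $m\in\mathbb{N}_0$. A non-singular M-matrix is a real square matrix with non-positive off-diagonal entries all of whose eigenvalues have positive real part (equivalently, with all principal minors positive). *)

(* Defs.v *)
From HB Require Import structures.
From mathcomp Require Import all_boot all_order all_algebra.
From mathcomp Require Import boolp classical_sets reals topology normedtype.
From mathcomp Require Import complex zify.
Set Implicit Arguments.
Unset Strict Implicit.
Unset Printing Implicit Defensive.
Import Order.TTheory GRing.Theory Num.Theory.
Import numFieldNormedType.Exports.

Local Open Scope ring_scope.

(* [eigenvalue] is about row eigenvectors; a square matrix has the same
   eigenvalues for row and for column eigenvectors. *)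
Definition nonsingular_Mmatrix (R : rcfType) (n : nat) (A : 'M[R]_n) : Prop :=
  (forall i j, i != j -> A i j <= 0) /\
  (forall lambda : R[i],
     eigenvalue (map_mx (real_complex R) A) lambda -> 0 < complex.Re lambda).

(* A [_hat] field belongs to the equations of the x_i, a [_til] field to those
   of the y_j. *)
Record bam (R : realType) (N1 N2 : nat) := Bam {
  tau : nat;
  c_hat : 'I_N1 -> R;
  c_til : 'I_N2 -> R;
  a_hat : 'I_N1 -> 'I_N2 -> R;
  a_til : 'I_N2 -> 'I_N1 -> R;
  b_hat : 'I_N1 -> 'I_N2 -> R;
  b_til : 'I_N2 -> 'I_N1 -> R;
  I_hat : 'I_N1 -> R;
  I_til : 'I_N2 -> R;
  tau_hat : 'I_N1 -> 'I_N2 -> nat -> nat;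
  tau_til : 'I_N2 -> 'I_N1 -> nat -> nat;
  act_f : 'I_N2 -> R -> R;
  act_g : 'I_N1 -> R -> R
}.

Section Model.
Variables (R : realType) (N1 N2 : nat) (P : bam R N1 N2).

(* A function z = (x, y) on the integers >= r is represented by a function on
   [int]; its values below r are junk, and nothing below depends on them. *)
Definition xs (z : int -> 'cV[R]_(N1 + N2)) (i : 'I_N1) (m : int) : R :=
  z m (lshift N2 i) 0.
Definition ys (z : int -> 'cV[R]_(N1 + N2)) (j : 'I_N2) (m : int) : R :=
  z m (rshift N1 j) 0.

Definition is_solution (z : int -> 'cV[R]_(N1 + N2)) : Prop :=
  forall m : nat,
    (forall i : 'I_N1,
       xs z i (m%:Z + 1) =
         c_hat P i * xs z i (m%:Z - (tau P)%:Z)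
         + \sum_(j < N2) a_hat P i j * act_f P j (ys z j m%:Z)
         + \sum_(j < N2)
             b_hat P i j * act_f P j (ys z j (m%:Z - (tau_hat P i j m)%:Z))
         + I_hat P i) /\
    (forall j : 'I_N2,
       ys z j (m%:Z + 1) =
         c_til P j * ys z j (m%:Z - (tau P)%:Z)
         + \sum_(i < N1) a_til P j i * act_g P i (xs z i m%:Z)
         + \sum_(i < N1)
             b_til P j i * act_g P i (xs z i (m%:Z - (tau_til P j i m)%:Z))
         + I_til P j).

Definition is_equilibrium (e : 'cV[R]_(N1 + N2)) : Prop :=
  is_solution (fun=> e).

Definition bounded_delays : Prop :=
  (forall i j, exists B, forall m, (tau_hat P i j m <= B)%N) /\
  (forall j i, exists B, forall m, (tau_til P j i m <= B)%N).

Definition delays : set nat :=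
  [set d | d = tau P \/ (exists i j m, d = tau_hat P i j m)
                     \/ (exists j i m, d = tau_til P j i m)]%classic.

(* max_delay = -r. The default value 0 is used only for unbounded delays. *)
Definition max_delay : nat := xget 0%N (delays `&` ubound delays)%classic.

Lemma max_delayP : bounded_delays ->
  delays max_delay /\ (forall d, delays d -> (d <= max_delay)%N).
Proof.
move=> [Bh Bt].
have [bh Hh] : exists b : 'I_N1 -> 'I_N2 -> nat,
    forall i j m, (tau_hat P i j m <= b i j)%N.
  by exists (fun i => projT1 (choice (Bh i))) => i; case: choice.
have [bt Ht] : exists b : 'I_N2 -> 'I_N1 -> nat,
    forall j i m, (tau_til P j i m <= b j i)%N.
  by exists (fun j => projT1 (choice (Bt j))) => j; case: choice.
pose B := (tau P + \sum_i \sum_j bh i j + \sum_j \sum_i bt j i)%N.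
have ubB d : `[< delays d >] -> (d <= B)%N.
  move=> /asboolP [->|[[i [j [m ->]]]|[j [i [m ->]]]]].
  - by rewrite /B -addnA leq_addr.
  - apply: leq_trans (Hh i j m) _; rewrite /B (bigD1 i) //= (bigD1 j) //=.
    by lia.
  - apply: leq_trans (Ht j i m) _; rewrite /B (bigD1 j (P := xpredT)) //=.
    by rewrite (bigD1 i (P := xpredT) (F := bt j)) //=; lia.
have exd : exists d, `[< delays d >] by exists (tau P); apply/asboolP; left.
have [M /asboolP DM maxM] := ex_maxnP exd ubB.
have DUM : (delays `&` ubound delays)%classic M.
  by split=> // d Dd; rewrite leEnat; apply/maxM/asboolP.
have [D U] := xgetI 0%N DUM.
by split=> // d /U; rewrite leEnat.
Qed.

End Model.

(* The functions on the integers -K, ..., 0: the index k stands for the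
   argument -k. *)
Definition X (R : realType) (K : nat) := {ffun 'I_K.+1 -> R}.
Definition XN (R : realType) (K N : nat) := {ffun 'I_N -> X R K}.

(* All terms are nonnegative, hence the default value 0 is harmless. *)
Definition normX (R : realType) (K : nat) (a : X R K) : R :=
  \big[Num.max/0]_(k < K.+1) `|a k|.
Definition normXN (R : realType) (K N : nat) (a : XN R K N) : R :=
  \big[Num.max/0]_(i < N) normX (a i).

Definition segment (R : realType) (K N : nat) (z : int -> 'cV[R]_N) (m : int) :
    XN R K N :=
  [ffun i => [ffun k : 'I_K.+1 => z (m - k%:Z) i 0]].

Section InitialValueProblem.
Variables (R : realType) (N1 N2 : nat) (P : bam R N1 N2).

Definition next (z : int -> 'cV[R]_(N1 + N2)) (m : nat) : 'cV[R]_(N1 + N2) :=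
  col_mx
    (\col_i (c_hat P i * xs z i (m%:Z - (tau P)%:Z)
         + \sum_(j < N2) a_hat P i j * act_f P j (ys z j m%:Z)
         + \sum_(j < N2)
             b_hat P i j * act_f P j (ys z j (m%:Z - (tau_hat P i j m)%:Z))
         + I_hat P i))
    (\col_j (c_til P j * ys z j (m%:Z - (tau P)%:Z)
         + \sum_(i < N1) a_til P j i * act_g P i (xs z i m%:Z)
         + \sum_(i < N1)
             b_til P j i * act_g P i (xs z i (m%:Z - (tau_til P j i m)%:Z))
         + I_til P j)).

Lemma is_solutionE z :
  is_solution P z <-> forall m : nat, z (m%:Z + 1) = next z m.
Proof.
split=> [H m|H m].
  apply/colP => k; rewrite -[k]splitK; have [Hx Hy] := H m.
  case: (split k) => l /=; rewrite ?col_mxEu ?col_mxEd mxE.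
    exact: Hx.
  exact: Hy.
by split=> l; rewrite {1}/xs {1}/ys H ?col_mxEu ?col_mxEd mxE.
Qed.

Lemma next_eq z z' (m : nat) : bounded_delays P ->
  (forall l : int, - (max_delay P)%:Z <= l <= m%:Z -> z l = z' l) ->
  next z m = next z' m.
Proof.
move=> /max_delayP [_ U] E.
have E' d : delays P d -> z (m%:Z - d%:Z) = z' (m%:Z - d%:Z).
  by move=> /U Ud; apply: E; lia.
have E0 : z m%:Z = z' m%:Z by apply: E; lia.
rewrite /next /xs /ys E0 (E' (tau P)) ; last by left.
congr col_mx; apply/colP => i; rewrite !mxE; congr (_ + _ + _).
  by apply: eq_bigr => j _; rewrite E' //; right; left; exists i, j, m.
by apply: eq_bigr => j _; rewrite E' //; right; right; exists i, j, m.
Qed.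

Lemma solution_unique z z' : bounded_delays P ->
  is_solution P z -> is_solution P z' ->
  segment (max_delay P) z 0 = segment (max_delay P) z' 0 ->
  forall m : int, - (max_delay P)%:Z <= m -> z m = z' m.
Proof.
move=> bP /is_solutionE Sz /is_solutionE Sz' E0.
have E (n : nat) : forall l : int,
    - (max_delay P)%:Z <= l <= n%:Z -> z l = z' l.
  elim: n => [|n IHn] l /andP[lK ln].
    have lt : (`|l| < (max_delay P).+1)%N by lia.
    apply/colP => i; have /ffunP/(_ i)/ffunP/(_ (Ordinal lt)) := E0.
    by rewrite !ffunE /= sub0r; have -> : - `|l|%N%:Z = l by lia.
  case: (ltrP n%:Z l) => [nl|ln']; last by apply: IHn; rewrite lK.
  have -> : l = n%:Z + 1 by lia.
  by rewrite Sz Sz'; apply: next_eq.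
by move=> m Km; apply: (E `|m|%N); lia.
Qed.

Lemma solution_exists (alpha : XN R (max_delay P) (N1 + N2)) :
  bounded_delays P ->
  exists z, is_solution P z /\ segment (max_delay P) z 0 = alpha.
Proof.
move=> bP.
pose h0 (l : int) : 'cV[R]_(N1 + N2) := \col_i alpha i (inord `|l|%N).
pose h := fix h (n : nat) : int -> 'cV[R]_(N1 + N2) :=
  if n is k.+1 then
    fun l => if l == k%:Z + 1 then next (h k) k else h k l
  else h0.
have hE (n k : nat) (l : int) : l <= n%:Z -> h (n + k)%N l = h n l.
  move=> ln; elim: k => [|k IHk]; first by rewrite addn0.
  rewrite addnS /=; case: eqP => [|_]; last exact: IHk.
  by lia.
pose z (l : int) := if l <= 0 then h0 l else h `|l|%N l.
have zh (n : nat) (l : int) : l <= n%:Z -> z l = h n l.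
  move=> ln; rewrite /z; case: (lerP l 0) => l0.
    by have := @hE 0%N n l l0; rewrite add0n => ->.
  have -> : n = (`|l| + (n - `|l|))%N by lia.
  by rewrite hE //; lia.
exists z; split.
  apply/is_solutionE => m; rewrite (zh m.+1); last by lia.
  rewrite /= eqxx; apply: next_eq => // l /andP[_ lm]; by rewrite (zh m).
apply/ffunP => i; apply/ffunP => k; rewrite !ffunE sub0r /z.
have -> : - (k : nat)%:Z <= 0 by lia.
rewrite /h0 mxE; congr (alpha i _); apply: val_inj => /=.
by rewrite abszN absz_nat inordK.
Qed.

End InitialValueProblem.

(* By [solution_exists] and [solution_unique], z below is the solution with
   initial segment alpha. *)
Definition globally_exponentially_stable (R : realType) (N1 N2 : nat)
    (P : bam R N1 N2) (e : 'cV[R]_(N1 + N2)) : Prop :=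
  exists C zeta : R, [/\ 0 < C, 0 < zeta, zeta < 1 &
    forall (alpha : XN R (max_delay P) (N1 + N2))
           (z : int -> 'cV[R]_(N1 + N2)),
      is_solution P z -> segment (max_delay P) z 0 = alpha ->
      forall m : nat,
        normXN (segment (max_delay P) z m%:Z
                - segment (max_delay P) (fun=> e) m%:Z)
        <= C * zeta ^+ m
           * normXN (alpha - segment (max_delay P) (fun=> e) 0)].

(* Main.v *)
From HB Require Import structures.
Require Import Defs.
From mathcomp Require Import all_boot all_order all_algebra.
From mathcomp Require Import boolp classical_sets reals topology normedtype.
From mathcomp Require Import functions interval_inference sequences.
From mathcomp Require Import complex zify ring lra.
Set Implicit Arguments.
Unset Strict Implicit.
Unset Printing Implicit Defensive.
Import Order.TTheory GRing.Theory Num.Theory.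
Import numFieldNormedType.Exports.
Local Open Scope ring_scope.

(** Write the matrix of the theorem as [1 - T]. The entry of [T] in row [k] and
    column [l] bounds the effect of a change of component [l], at the present
    or at delayed times, on the next value of component [k]: if two histories
    differ, on the window of length [max_delay], by at most [s] componentwise,
    then their next values differ by at most [T *m s] ([next_dist]). This
    comparison is all that is used of the model, and it serves both for the
    equilibrium and for its stability.

    The hypothesis on the eigenvalues of [A = 1 - T] gives a vector [u > 0] with
    [A *m u > 0] ([Mmatrix_semipositive]), hence [T *m u <= lambda *: u] for
    some [lambda < 1]: in the norm [max_k |x_k| / u_k] the map [T] is a strict
    contraction. To find [u], consider the set of the [t >= 0] for which
    [A + t] has such a vector; it contains all large [t]. Since [- t] is never
    an eigenvalue of [A], all the matrices [A + t] are invertible. For [t] in the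
    set close to its infimum [t0], the solution [u] of [(A + t) *m u = 1] is
    nonnegative, because a Z-matrix with a positive vector of positive image is
    inverse-positive ([Zmatrix_monotone]), and it is bounded independently of
    [t] by means of the inverse of [A + t0]. Therefore [u] is still good for
    [s = max (t0 - d) 0], with a [d > 0] independent of [t]. As [s] is in the
    set, [s >= t0], which leaves only [s = 0].

    Equilibria are the fixed points of the map sending [x] to the next value of
    the constant history [x]. By [next_dist] this map is a contraction in the
    weighted norm, so that one exists by the Banach fixed point theorem
    ([weighted_fixed_point]). If [e] and [e'] are equilibria,
    [d = |e' - e|] satisfies [d <= T *m d], that is [A *m (- d) >= 0], so that
    [- d >= 0] by [Zmatrix_monotone].

    For the stability, choose [zeta < 1] with [lambda <= zeta ^+ K.+1], where [K]
    is the maximal delay. If [|z - e| <= M * zeta ^+ n *: u] holds at times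
    [n - K] for the [n] of a full window, the worst bound on that window is that
    at its left end, [K.+1] steps before the next time, and the factor [lambda]
    gained in one step pays for these [K.+1] steps ([solution_decay]). *)

(** * Z-matrices and M-matrices *)

Section ZMatrix.
Variables (R : realFieldType) (n : nat) (A : 'M[R]_n).
Hypothesis AZ : forall i j, i != j -> A i j <= 0.

(** If [x] had a negative entry, at an index [i] minimizing [x i / u i] the
    vector [A *m x] would be at most the negative multiple
    [x i / u i] of [A *m u], because the off-diagonal entries of [A] reverse
    the inequalities [x j >= (x i / u i) * u j]. *)
Lemma Zmatrix_monotone (u x : 'cV[R]_n) :
  (forall i, 0 < u i 0) -> (forall i, 0 < (A *m u) i 0) ->
  (forall i, 0 <= (A *m x) i 0) -> forall i, 0 <= x i 0.
Proof.
move=> u0 Au Ax k.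
case: (@arg_minP _ _ _ k xpredT (fun i => x i 0 / u i 0) isT) => i _ mi.
suff si : 0 <= x i 0 / u i 0.
  by have := le_trans si (mi k isT); rewrite pmulr_lge0 // invr_gt0.
rewrite leNgt; apply/negP => s0; set s := x i 0 / u i 0 in mi s0.
have : (A *m x) i 0 <= s * (A *m u) i 0.
  rewrite !mxE mulr_sumr; apply: ler_sum => j _; rewrite mulrCA.
  have [<-|ij] := eqVneq i j; first by rewrite /s divfK // gt_eqF.
  by rewrite ler_wnM2l ?AZ // -ler_pdivlMr ?mi.
by rewrite leNgt (lt_le_trans _ (Ax i)) // pmulr_llt0.
Qed.

Lemma Zmatrix_pos (u : 'cV[R]_n) :
  (forall i, 0 <= u i 0) -> (forall i, 0 < (A *m u) i 0) ->
  forall i, 0 < u i 0.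
Proof.
move=> u0 Au i; rewrite lt_def u0 andbT; apply/eqP => ui.
have := Au i; rewrite mxE ltNge; apply/negP/negPn; apply: sumr_le0 => j _.
have [<-|ij] := eqVneq i j; first by rewrite ui mulr0.
by rewrite mulr_le0_ge0 // AZ.
Qed.

End ZMatrix.

(** Only the real eigenvalues matter: a singular [A + t] would make [- t] one
    of them. *)
Lemma Mmatrix_shift_unit (R : rcfType) (n : nat) (A : 'M[R]_n) (t : R) :
  nonsingular_Mmatrix A -> 0 <= t -> A + t%:M \in unitmx.
Proof.
move=> [_ Aev] t0; rewrite unitmxE unitfE; apply/negP => /det0P[v v0 vA].
have : eigenvalue A (- t).
  apply/eigenvalueP; exists v => //; apply/eqP.
  by rewrite scaleNr -addr_eq0 -mul_mx_scalar -mulmxDr vA.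
rewrite -(eigenvalue_map (real_complex R)) => /Aev /=.
by rewrite oppr_gt0 ltNge t0.
Qed.

Lemma mulmx_le_sum (R : realFieldType) (n : nat) (B : 'M[R]_n) (x : 'cV[R]_n)
    (c : R) i :
  (forall j, `|x j 0| <= c) -> (B *m x) i 0 <= (\sum_k \sum_j `|B k j|) * c.
Proof.
move=> xc; have c0 : 0 <= c := le_trans (normr_ge0 _) (xc i).
apply: (@le_trans _ _ (\sum_j `|B i j| * c)).
  rewrite mxE; apply: ler_sum => j _; apply: le_trans (ler_norm _) _.
  by rewrite normrM ler_wpM2l.
rewrite -mulr_suml ler_wpM2r // [leRHS](bigD1 i) //= lerDl.
by apply: sumr_ge0 => k _; apply: sumr_ge0.
Qed.

(** A continuity argument along the path [A + t], from large [t] down to 0. *)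
Lemma Mmatrix_semipositive (R : realType) (n : nat) (A : 'M[R]_n) :
  nonsingular_Mmatrix A ->
  exists2 u : 'cV[R]_n, (forall i, 0 < u i 0) & forall i, 0 < (A *m u) i 0.
Proof.
move=> AM; have AZ := AM.1.
have shiftZ t i j : i != j -> (A + t%:M) i j <= 0.
  by move=> ij; rewrite !mxE (negPf ij) addr0 AZ.
pose S : set R := [set t | 0 <= t /\ exists2 u : 'cV[R]_n,
  (forall i, 0 < u i 0) & forall i, 0 < ((A + t%:M) *m u) i 0]%classic.
have Snz : (S !=set0)%classic.
  (* This shift makes [A] strictly diagonally dominant, and [u = 1] works. *)
  exists (1 + \sum_k \sum_j `|A k j|); split.
    by rewrite addr_ge0 // sumr_ge0 // => k _; rewrite sumr_ge0.
  exists (const_mx 1) => i; first by rewrite mxE.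
  rewrite mulmxDl mul_scalar_mx !mxE mulr1.
  have one_le j : `|(const_mx 1 : 'cV[R]_n) j 0| <= 1 by rewrite mxE normr1.
  have := mulmx_le_sum (- A) i one_le.
  under eq_bigr do under eq_bigr do rewrite mxE normrN.
  by rewrite mulNmx mxE [(A *m _) i 0]mxE mulr1; lra.
have Slb : has_inf S by split=> //; exists 0 => t [].
set t0 := inf S.
have t00 : 0 <= t0 by apply: lb_le_inf => // t [].
pose B := invmx (A + t0%:M).
(* [beta] bounds the norm of [B], and it is positive even when [B = 0]. *)
pose beta := 1 + \sum_k \sum_j `|B k j|.
have beta1 : 1 <= beta by rewrite lerDl sumr_ge0 // => k _; rewrite sumr_ge0.
pose d := (4 * beta)^-1.
have d0 : 0 < d by rewrite invr_gt0; lra.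
have dbeta : beta * d = 4^-1 by rewrite /d invfM mulrCA divff ?mulr1 //; lra.
have [t [tge [v v0 Av]] tlt] := inf_adherent d0 Slb.
have t0t : t0 <= t by apply: ge_inf; [case: Slb | split=> //; exists v].
have [u Au] : exists u : 'cV[R]_n, (A + t%:M) *m u = const_mx 1.
  exists (invmx (A + t%:M) *m const_mx 1).
  by rewrite mulmxA mulmxV ?mul1mx // Mmatrix_shift_unit.
have u0 : forall i, 0 <= u i 0.
  by apply: (Zmatrix_monotone (shiftZ t) v0 Av) => i; rewrite Au mxE.
(* The same [u] is used for all the shifts [s], in particular for [t0]. *)
have AuE s : (A + s%:M) *m u = const_mx 1 - (t - s) *: u.
  rewrite -Au !mulmxDl !mul_scalar_mx scalerBl.
  by apply/colP => k; rewrite !mxE; ring.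
(* At [s = t0] the equation reads [u = B *m (1 - (t - t0) *: u)], so that
   [max u <= beta * (1 + d * max u)] with [beta * d = 1 / 4]. *)
have ule k : u k 0 <= 2 * beta.
  case: (@arg_maxP _ _ _ k xpredT (fun i => u i 0) isT) => i _ mi.
  apply: le_trans (mi k isT) _; set c := u i 0 in mi *.
  have c0 : 0 <= c := u0 i.
  have : u = B *m (const_mx 1 - (t - t0) *: u).
    by rewrite -AuE mulmxA mulVmx ?mul1mx // Mmatrix_shift_unit.
  move/(congr1 (fun w : 'cV[R]_n => w i 0)); rewrite -/c => cE.
  have : c <= (beta - 1) * (1 + d * c).
    rewrite {1}cE [beta - 1]addrC addKr; apply: mulmx_le_sum => j.
    rewrite !mxE; apply: le_trans (ler_normB _ _) _.
    rewrite normr1 lerD2l normrM !ger0_norm ?subr_ge0 // ler_pM ?subr_ge0 //;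
      last exact: mi.
    by rewrite lerBlDl ltW.
  have := mulr_ge0 (ltW d0) c0.
  have -> : (beta - 1) * (1 + d * c) = beta - 1 + (beta * d) * c - d * c.
    by ring.
  by rewrite dbeta; lra.
(* [(t - s) * max u < 2 * d * (2 * beta) = 1], so that [(A + s) *m u > 0]. *)
pose s := Num.max (t0 - d) 0.
have ts : 0 <= t - s < 2 * d.
  by rewrite /s; case: (leP (t0 - d) 0) => ?; apply/andP; split; lra.
have Ss : S s.
  have As i : 0 < ((A + s%:M) *m u) i 0.
    rewrite AuE !mxE subr_gt0.
    have := u0 i; rewrite le_eqVlt => /orP[/eqP <-|ui]; first by rewrite mulr0.
    apply: (@lt_le_trans _ _ (2 * d * (2 * beta))); last first.
      have -> : 2 * d * (2 * beta) = 4 * (beta * d) by ring.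
      by rewrite dbeta; lra.
    case/andP: ts => ts1 ts2.
    apply: (@lt_le_trans _ _ (2 * d * u i 0)); first by rewrite ltr_pM2r.
    by rewrite ler_wpM2l // ltW // mulr_gt0.
  split; first by rewrite le_max lexx orbT.
  by exists u => //; apply: (Zmatrix_pos (shiftZ s)).
have s0 : s = 0.
  have : t0 <= s by apply: ge_inf => //; case: Slb.
  by rewrite /s; case: (leP (t0 - d) 0) => // ?; lra.
by case: Ss => _ [w w0 Aw]; exists w => //; move: Aw; rewrite s0 raddf0 addr0.
Qed.

(** The lower bound 1/2 imposed on [lambda] keeps positive the decay rate
    derived from it, also when [T] vanishes. *)
Lemma semipositive_contraction (R : realFieldType) (n : nat) (T : 'M[R]_n)
    (u : 'cV[R]_n) :
  (forall i, 0 < u i 0) -> (forall i, 0 < ((1%:M - T) *m u) i 0) ->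
  exists2 lambda : R, 0 < lambda < 1 & forall i, (T *m u) i 0 <= lambda * u i 0.
Proof.
move=> u0 Tu.
exists (\big[Num.max/2^-1]_(i < n) ((T *m u) i 0 / u i 0)).
  apply/andP; split.
    apply: lt_le_trans (_ : 2^-1 <= _); first by rewrite invr_gt0.
    exact: bigmax_ge_id.
  apply/bigmax_ltP; split; first by lra.
  move=> i _; have := Tu i; rewrite ltr_pdivrMr // mul1r mulmxBl mul1mx.
  by rewrite [X in 0 < X -> _]mxE [X in 0 < _ + X -> _]mxE subr_gt0.
move=> i; rewrite -ler_pdivrMr //.
exact: (@le_bigmax _ _ _ _ (fun i => (T *m u) i 0 / u i 0)).
Qed.

(** * Fixed points of maps dominated by a matrix *)

Lemma mx_norm_leP (R : realType) (n : nat) (x : 'cV[R]_n) (c : R) : 0 <= c ->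
  `|x| <= c <-> forall i, `|x i 0| <= c.
Proof.
move=> c0; have -> : `|x| = \big[Num.max/0]_ij `|x ij.1 ij.2| := mx_normrE x.
split=> [xc i|xc].
  by move/bigmax_leP: xc => [_ /(_ (i, 0) isT)].
by apply/bigmax_leP; split=> // -[i j] _ /=; rewrite (ord1 j).
Qed.

(** The change of variables [x i = u i * w i] turns the weighted norm into the
    usual maximum norm, for which the conjugated map is a contraction. *)
Lemma weighted_fixed_point (R : realType) (n : nat) (T : 'M[R]_n)
    (u : 'cV[R]_n) (lambda : R) (Phi : 'cV[R]_n -> 'cV[R]_n) :
  (forall i, 0 < u i 0) -> 0 <= lambda < 1 ->
  (forall i, (T *m u) i 0 <= lambda * u i 0) ->
  (forall x y s : 'cV[R]_n, (forall j, `|x j 0 - y j 0| <= s j 0) ->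
     forall i, `|Phi x i 0 - Phi y i 0| <= (T *m s) i 0) ->
  exists e, Phi e = e.
Proof.
move=> u0 /andP[lambda0 lambda1] Tu PhiT.
pose V := HB.pack_for (completeNormedModType R) 'cV[R]_n.
pose W (w : 'cV[R]_n) : 'cV[R]_n := \col_i (u i 0 * w i 0).
pose g (w : V) : V := \col_i (Phi (W w) i 0 / u i 0).
have gctr : @is_contraction _ V V setT setT (totalfun g).
  exists (NngNum lambda0); split; first exact: lambda1.
  move=> [x y] _ /=.
  apply/mx_norm_leP => [|i]; first by rewrite mulr_ge0.
  rewrite !mxE -mulrBl normrM normfV (gtr0_norm (u0 i)) ler_pdivrMr //.
  apply: (@le_trans _ _ ((T *m (`|x - y| *: u)) i 0)); last first.
    by rewrite -scalemxAr mxE mulrAC mulrC ler_wpM2r.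
  apply: PhiT => j; rewrite !mxE -mulrBr normrM (gtr0_norm (u0 j)) mulrC.
  rewrite ler_wpM2r ?(ltW (u0 j)) //.
  by have := (mx_norm_leP (x - y) (normr_ge0 _)).1 (lexx _) j; rewrite !mxE.
have [||p _ pg] := banach_fixed_point gctr; first exact: closedT.
  by exists (0 : V).
exists (W p); apply/colP => i; rewrite [RHS]mxE.
by rewrite {2}pg mxE mulrC divfK // gt_eqF.
Qed.

(** * Comparison of two histories *)

Lemma lipschitz_ge0 (R : realType) (f : R -> R) (L : R) :
  L.-lipschitz f -> 0 <= L.
Proof.
move=> /(_ (1, 0) (conj I I)) /=; rewrite subr0 normr1 mulr1.
exact: le_trans (normr_ge0 _).
Qed.

(** The equations for the two layers have the same form, hence this common
    estimate. *)
Lemma neuron_dist (R : realType) (n : nat) (c v v' sv : R) (a b L s : 'I_n -> R)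
    (f : 'I_n -> R -> R) (p p' q q' : 'I_n -> R) (J : R) :
  (forall j, (L j).-lipschitz (f j)) -> `|v - v'| <= sv ->
  (forall j, `|p j - p' j| <= s j) -> (forall j, `|q j - q' j| <= s j) ->
  `|(c * v + \sum_(j < n) a j * f j (p j)
     + \sum_(j < n) b j * f j (q j) + J)
    - (c * v' + \sum_(j < n) a j * f j (p' j)
       + \sum_(j < n) b j * f j (q' j) + J)|
  <= `|c| * sv + \sum_(j < n) (`|a j| + `|b j|) * L j * s j.
Proof.
move=> fLip vs ps qs.
have -> : forall A B C A' B' C' : R,
    A + B + C + J - (A' + B' + C' + J) = (A - A') + ((B - B') + (C - C')).
  by move=> *; ring.
rewrite -mulrBr -!sumrB -big_split /=; apply: le_trans (ler_normD _ _) _.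
apply: lerD; first by rewrite normrM ler_wpM2l.
apply: le_trans (ler_norm_sum _ _ _) _; apply: ler_sum => j _.
have lip x x' : `|x - x'| <= s j -> `|f j x - f j x'| <= L j * s j.
  move=> xs; apply: le_trans (fLip j (x, x') (conj I I)) _ => /=.
  by rewrite ler_wpM2l // (lipschitz_ge0 (@fLip j)).
rewrite -!mulrBr; apply: le_trans (ler_normD _ _) _.
rewrite !normrM -mulrA mulrDl.
by apply: lerD; rewrite ler_wpM2l // lip.
Qed.

Section Comparison.
Variables (R : realType) (N1 N2 : nat) (P : bam R N1 N2).
Variables (F : 'I_N2 -> R) (G : 'I_N1 -> R).
Hypothesis fL : forall j, (F j).-lipschitz (act_f P j).
Hypothesis gL : forall i, (G i).-lipschitz (act_g P i).

(** The matrix [T] for which the matrix of the theorem is [1 - T]. *)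
Definition gain : 'M[R]_(N1 + N2) :=
  diag_mx (row_mx (\row_(i < N1) `|c_hat P i|) (\row_(j < N2) `|c_til P j|))
  + block_mx 0
      (\matrix_(i < N1, j < N2) ((`|a_hat P i j| + `|b_hat P i j|) * F j))
      (\matrix_(j < N2, i < N1) ((`|a_til P j i| + `|b_til P j i|) * G i))
      0.

Lemma gain_hat (s : 'cV[R]_(N1 + N2)) i :
  (gain *m s) (lshift N2 i) 0 = `|c_hat P i| * s (lshift N2 i) 0
   + \sum_(j < N2) (`|a_hat P i j| + `|b_hat P i j|) * F j * s (rshift N1 j) 0.
Proof.
rewrite mulmxDl mxE mul_diag_mx mxE row_mxEl mxE; congr (_ + _).
rewrite mxE big_split_ord /= big1 ?add0r => [|j _].
  by apply: eq_bigr => j _; rewrite block_mxEur mxE.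
by rewrite block_mxEul mxE mul0r.
Qed.

Lemma gain_til (s : 'cV[R]_(N1 + N2)) j :
  (gain *m s) (rshift N1 j) 0 = `|c_til P j| * s (rshift N1 j) 0
   + \sum_(i < N1) (`|a_til P j i| + `|b_til P j i|) * G i * s (lshift N2 i) 0.
Proof.
rewrite mulmxDl mxE mul_diag_mx mxE row_mxEr mxE; congr (_ + _).
rewrite mxE big_split_ord /= addrC big1 ?add0r => [|i _].
  by apply: eq_bigr => i _; rewrite block_mxEdl mxE.
by rewrite block_mxEdr mxE mul0r.
Qed.

(** Each term of the equations reads the history at one time of the window,
    and the bound [s] is uniform on the window, so that the present and the
    delayed terms add up to a single application of [gain]. *)
Lemma next_dist (z z' : int -> 'cV[R]_(N1 + N2)) (m : nat)
    (s : 'cV[R]_(N1 + N2)) :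
  bounded_delays P ->
  (forall (l : int) k, m%:Z - (max_delay P)%:Z <= l <= m%:Z ->
     `|z l k 0 - z' l k 0| <= s k 0) ->
  forall k, `|Defs.next P z m k 0 - Defs.next P z' m k 0| <= (gain *m s) k 0.
Proof.
move=> /max_delayP [_ dK] zs.
have zsd d k : delays P d ->
    `|z (m%:Z - d%:Z) k 0 - z' (m%:Z - d%:Z) k 0| <= s k 0.
  by move=> /dK dle; apply: zs; lia.
have zs0 k : `|z m%:Z k 0 - z' m%:Z k 0| <= s k 0 by apply: zs; lia.
move=> k; case: (split_ordP k) => i ->.
  rewrite gain_hat !col_mxEu !mxE; apply: neuron_dist => // [|j|j];
    [|exact: zs0|].
    by apply: zsd; left.
  by apply: zsd; right; left; exists i, j, m.
rewrite gain_til !col_mxEd !mxE; apply: neuron_dist => // [|j|j];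
    [|exact: zs0|].
  by apply: zsd; left.
by apply: zsd; right; right; exists i, j, m.
Qed.

End Comparison.

(** * Exponential stability *)

Lemma bernoulli_ineq (R : realDomainType) (x : R) n :
  0 <= x <= 1 -> 1 - n%:R * x <= (1 - x) ^+ n.
Proof.
move=> /andP[x0 x1]; elim: n => [|n IHn]; first by rewrite mul0r subr0 expr0.
rewrite exprS; apply: (@le_trans _ _ ((1 - x) * (1 - n%:R * x))).
  by rewrite -natr1; have := mulr_ge0 (ler0n R n) (mulr_ge0 x0 x0); lra.
by rewrite ler_wpM2l // subr_ge0.
Qed.

(** Take [zeta = 1 - (1 - lambda) / K.+1] and apply Bernoulli's inequality. *)
Lemma exists_rate (R : realFieldType) (lambda : R) (K : nat) :
  0 < lambda < 1 -> exists2 zeta : R, 0 < zeta < 1 & lambda <= zeta ^+ K.+1.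
Proof.
move=> /andP[l0 l1]; pose x := (1 - lambda) / K.+1%:R.
have K0 : 0 < K.+1%:R :> R by rewrite ltr0n.
have x0 : 0 < x by rewrite divr_gt0 ?subr_gt0.
have x1 : x < 1.
  rewrite ltr_pdivrMr // mul1r.
  by have := ler1n R K.+1; rewrite ltnS leq0n; lra.
exists (1 - x); first by apply/andP; split; lra.
have /(bernoulli_ineq K.+1) : 0 <= x <= 1 by apply/andP; split; lra.
by rewrite mulrC divfK ?gt_eqF // opprB addrC subrK.
Qed.

Lemma norm_le_normXN (R : realType) (Q N : nat) (a : XN R Q N) i k :
  `|a i k| <= normXN a.
Proof.
apply: (@le_trans _ _ (normX (a i))).
  exact: (@le_bigmax _ _ _ _ (fun k => `|a i k|)).
exact: (@le_bigmax _ _ _ _ (fun i => normX (a i))).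
Qed.

Lemma normXN_le (R : realType) (Q N : nat) (a : XN R Q N) c :
  0 <= c -> (forall i k, `|a i k| <= c) -> normXN a <= c.
Proof.
by move=> c0 ac; apply/bigmax_leP; split=> // i _; apply/bigmax_leP; split.
Qed.

(** The delays disappear on constant histories, so that the equation at time 0
    is the equation at all times. *)
Lemma equilibriumE (R : realType) (N1 N2 : nat) (P : bam R N1 N2)
    (e : 'cV[R]_(N1 + N2)) :
  is_equilibrium P e <-> Defs.next P (fun=> e) 0 = e.
Proof.
rewrite /is_equilibrium is_solutionE; split=> [/(_ 0%N)//|eN m].
by rewrite -[LHS]eN.
Qed.

Section Stability.
Variables (R : realType) (N1 N2 : nat) (P : bam R N1 N2).
Variables (F : 'I_N2 -> R) (G : 'I_N1 -> R).
Hypothesis bP : bounded_delays P.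
Hypothesis fL : forall j, (F j).-lipschitz (act_f P j).
Hypothesis gL : forall i, (G i).-lipschitz (act_g P i).
Variables (u : 'cV[R]_(N1 + N2)) (lambda : R).
Hypothesis u0 : forall i, 0 < u i 0.
Hypothesis Tu : forall i, (gain P F G *m u) i 0 <= lambda * u i 0.

Let K := max_delay P.

(** The index [n] counts from the left end [- K] of the initial window, which
    keeps the exponents natural. The hypothesis bounds the initial window by the
    value that the estimate takes at its right end [n = K]. *)
Lemma solution_decay (e : 'cV[R]_(N1 + N2)) (z : int -> 'cV[R]_(N1 + N2))
    (zeta M : R) :
  is_equilibrium P e -> is_solution P z ->
  0 < zeta < 1 -> lambda <= zeta ^+ K.+1 -> 0 <= M ->
  (forall (n : nat) k, (n <= K)%N ->
     `|z (n%:Z - K%:Z) k 0 - e k 0| <= M * zeta ^+ K * u k 0) ->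
  forall (n : nat) k, `|z (n%:Z - K%:Z) k 0 - e k 0| <= M * zeta ^+ n * u k 0.
Proof.
move=> /is_solutionE eS /is_solutionE zS /andP[ze0 ze1] lz M0 init.
elim/ltn_ind=> n IHn k.
have [nK|Kn] := leqP n K.
  apply: le_trans (init _ _ nK) _; rewrite ler_wpM2r ?(ltW (u0 k)) //.
  by rewrite ler_wpM2l // ler_wiXn2l // ltW.
pose m := (n - K.+1)%N.
have -> : n%:Z - K%:Z = m%:Z + 1 by rewrite /m; lia.
have eSm : e = Defs.next P (fun=> e) m := eS m.
rewrite zS {1}eSm.
apply: le_trans (next_dist fL gL (s := (M * zeta ^+ m) *: u) bP _ k) _.
  move=> l j /andP[ml lm].
  have [q lq] : exists q : nat, l = q%:Z - K%:Z.
    by exists (absz (l + K%:Z)); lia.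
  rewrite lq; apply: le_trans (IHn q _ j) _; first by lia.
  rewrite mxE ler_wpM2r ?(ltW (u0 j)) // ler_wpM2l //.
  by rewrite ler_wiXn2l ?(ltW ze0) ?(ltW ze1) //; lia.
rewrite -scalemxAr mxE -!mulrA ler_wpM2l //.
have -> : n = (m + K.+1)%N by rewrite /m; lia.
rewrite exprD -mulrA ler_wpM2l ?exprn_ge0 ?(ltW ze0) //.
by apply: le_trans (Tu k) _; rewrite ler_wpM2r ?(ltW (u0 k)).
Qed.

Lemma equilibrium_ges (e : 'cV[R]_(N1 + N2)) :
  0 < lambda < 1 -> is_equilibrium P e -> globally_exponentially_stable P e.
Proof.
move=> l01 eE; have [zeta ze01 lz] := exists_rate K l01.
have /andP[ze0 ze1] := ze01.
(* [L] and [H] compare the weighted norm with the unweighted one; starting the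
   maxima at 1 makes them positive. *)
pose L := \big[Num.max/1]_k (u k 0)^-1; pose H := \big[Num.max/1]_k u k 0.
have L1 : 1 <= L by exact: bigmax_ge_id.
have H1 : 1 <= H by exact: bigmax_ge_id.
have uH k : u k 0 <= H by exact: (@le_bigmax _ _ _ _ (fun k => u k 0)).
have uL k : 1 <= L * u k 0.
  rewrite -ler_pdivrMr // mul1r.
  exact: (@le_bigmax _ _ _ _ (fun k => (u k 0)^-1)).
have zK0 : 0 < zeta ^+ K by rewrite exprn_gt0.
exists (H * (L / zeta ^+ K)), zeta; split=> //.
  by rewrite mulr_gt0 ?divr_gt0 //; lra.
move=> alpha z zS zalpha m.
set D := normXN (alpha - _).
have D0 : 0 <= D by apply: bigmax_ge_id.
pose M := D * L / zeta ^+ K.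
have M0 : 0 <= M by rewrite divr_ge0 ?mulr_ge0 ?(ltW zK0) //; lra.
have init (n : nat) k : (n <= K)%N ->
    `|z (n%:Z - K%:Z) k 0 - e k 0| <= M * zeta ^+ K * u k 0.
  move=> nK; rewrite divfK ?gt_eqF // -mulrA.
  apply: (@le_trans _ _ D); last by rewrite ler_peMr.
  have lt : (K - n < (max_delay P).+1)%N by rewrite ltnS leq_subr.
  have := norm_le_normXN (alpha - segment K (fun=> e) 0) k (Ordinal lt).
  rewrite -/D -zalpha !ffunE /=.
  by have -> : 0 - (K - n)%N%:Z = n%:Z - K%:Z by lia.
have dec := solution_decay eE zS ze01 lz M0 init.
apply: normXN_le => [|i k].
  by rewrite !mulr_ge0 ?invr_ge0 ?exprn_ge0 //; lra.
rewrite !ffunE /=.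
have kK : (k <= K)%N by rewrite -ltnS.
have -> : m%:Z - k%:Z = (m + (K - k))%N%:Z - K%:Z by lia.
apply: le_trans (dec _ _) _.
apply: (@le_trans _ _ (M * zeta ^+ m * H)); last first.
  by rewrite le_eqVlt; apply/orP; left; apply/eqP; rewrite /M; ring.
apply: ler_pM => //; [by rewrite mulr_ge0 ?exprn_ge0 ?(ltW ze0)|exact: ltW|].
by rewrite ler_wpM2l // ler_wiXn2l ?leq_addr // ltW.
Qed.

End Stability.

Theorem corollary5 (R : realType) (N1 N2 : nat) (P : bam R N1 N2)
    (F : 'I_N2 -> R) (G : 'I_N1 -> R) :
  (0 < N1)%N -> (0 < N2)%N ->
  (forall i, -1 < c_hat P i < 1) ->
  (forall j, -1 < c_til P j < 1) ->
  bounded_delays P ->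
  (forall j, (F j).-lipschitz (act_f P j)) ->
  (forall i, (G i).-lipschitz (act_g P i)) ->
  nonsingular_Mmatrix
    (1%:M
     - diag_mx (row_mx (\row_(i < N1) `|c_hat P i|) (\row_(j < N2) `|c_til P j|))
     - block_mx 0
         (\matrix_(i < N1, j < N2) ((`|a_hat P i j| + `|b_hat P i j|) * F j))
         (\matrix_(j < N2, i < N1) ((`|a_til P j i| + `|b_til P j i|) * G i))
         0) ->
  exists e : 'cV[R]_(N1 + N2),
    [/\ is_equilibrium P e,
        (forall e', is_equilibrium P e' -> e' = e)
      & globally_exponentially_stable P e].
Proof.
move=> _ _ _ _ bP fL gL; rewrite -addrA -opprD -/(gain P F G) => AM.
have [u u0 Au] := Mmatrix_semipositive AM.
have [lambda l01 Tu] := semipositive_contraction u0 Au.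
have l01' : 0 <= lambda < 1 by case/andP: l01 => l0 ->; rewrite ltW.
have next_cst_dist (x y s : 'cV[R]_(N1 + N2)) :
    (forall j, `|x j 0 - y j 0| <= s j 0) ->
    forall i, `|Defs.next P (fun=> x) 0 i 0 - Defs.next P (fun=> y) 0 i 0|
              <= (gain P F G *m s) i 0.
  by move=> xys; apply: next_dist.
have [e eN] := weighted_fixed_point u0 l01' Tu next_cst_dist.
have eE : is_equilibrium P e by apply/equilibriumE.
exists e; split=> // [e' /equilibriumE e'N|];
  last exact: equilibrium_ges Tu _ l01 eE.
pose d : 'cV[R]_(N1 + N2) := \col_i `|e' i 0 - e i 0|.
have dT i : d i 0 <= (gain P F G *m d) i 0.
  by rewrite mxE -{1}e'N -{1}eN next_cst_dist // => j; rewrite mxE.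
have d_le0 := Zmatrix_monotone AM.1 u0 Au (x := - d).
apply/colP => i; apply/eqP; rewrite -subr_eq0 -normr_le0.
have := d_le0 _ i; rewrite !mxE oppr_ge0; apply=> k.
by rewrite mulmxN mulmxBl mul1mx opprB mxE [X in _ + X]mxE subr_ge0.
Qed.
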